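(* Let $\lambda$ be an infinite cardinal with $\lambda = \lambda^{\aleph_0}$. Then there is no universal group in $\mathcal{LN}_\lambda$; that is, there is no locally nilpotent group $G$ with $|G|\le\lambda$ such that every locally nilpotent group $H$ with $|H|\le \lambda$ can be embedded into $G$.
   Context: A group $G$ is locally nilpotent if every finitely generated subgroup of $G$ is nilpotent. $\mathcal{LN}_\lambda$ denotes the class of all locally nilpotent groups of cardinality at most $\lambda$. A group $G\in\mathcal{LN}_\lambda$ is called universal in $\mathcal{LN}_\lambda$ if for every $H\in\mathcal{LN}_\lambda$ there is an injective group homomorphism $H\to G$. *)

(* Defs.v *)
From mathcomp Require Import all_boot.
From mathcomp Require Import boolp classical_sets functions cardinality.

Set Implicit Arguments.
Unset Strict Implicit.
Unset Printing Implicit Defensive.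

Local Open Scope group_scope.
Local Open Scope classical_set_scope.
Local Open Scope card_scope.

Section SubgroupsOfGroup.
Variable G : groupType.

Definition is_subgroup (H : set G) : Prop := group_closed (mem H).

Definition generated (A : set G) : set G := smallest is_subgroup A.

Definition commutator_subgroup (A B : set G) : set G :=
  generated [set z | exists x y, [/\ A x, B y & z = [~ x, y]]].

(* Indexing starts at 0: [lower_central H n] is $\gamma_{n+1}(H)$. *)
Fixpoint lower_central (H : set G) (n : nat) : set G :=
  if n is n'.+1 then commutator_subgroup (lower_central H n') H else H.

(* Meant for a subgroup [H] of [G]; since [lower_central H] stays inside [H],
   this is nilpotency of [H] as a group. *)
Definition nilpotent_subgroup (H : set G) : Prop :=
  exists n, lower_central H n `<=` [set 1].

Definition locally_nilpotent : Prop :=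
  forall A : set G, finite_set A -> nilpotent_subgroup (generated A).

End SubgroupsOfGroup.

(* A cardinal is represented by a type [L] having that cardinality. *)
Definition in_LN (L : Type) (G : groupType) : Prop :=
  locally_nilpotent G /\ ([set: G] #<= [set: L]).

Definition embeds (H G : groupType) : Prop :=
  exists f : {multiplicative H -> G}, injective f.

Definition universal_in_LN (L : Type) (G : groupType) : Prop :=
  in_LN L G /\ forall H : groupType, in_LN L H -> embeds H G.

(* Main.v *)
(* Let T be the tree of finite sequences in L. On functions
   option T -> F_2, seen as formal sums of the nodes and of one extra basis
   vector oo, let x_z send oo to oo + z, and, for a branch nu and a parity
   eps nu, let y_nu send nu|n to nu|n + nu|(n+1) for all n of that parity; all
   other basis vectors are fixed. Finitely many branches are pairwise distinct
   above some level, so any finite set of these involutions is unitriangular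
   for a finite filtration: they generate a locally nilpotent group H, of
   cardinality |L| because |L|^aleph_0 = |L|. Moreover [x_(nu|n), y_nu] =
   x_(nu|(n+1)) for n of the chosen parity.
   Given G with at most |L| elements, a branch nu can be read as a sequence g_n
   in G. Let y_nu be of odd type if G has y with [g_n, y] = g_(n+1) for all even
   n, and of even type otherwise. If f embeds H into G, choose nu coding
   g_n = f(x_(nu|n)). The even type is impossible as f(y_nu) would be a witness;
   in the odd type the commutators of g_0 with y, f(y_nu), y, f(y_nu), ...
   never vanish, so g_0, y and f(y_nu) generate a non-nilpotent group. *)

Require Import Defs.
From HB Require Import structures.
From mathcomp Require Import all_boot ssralg.
From mathcomp Require Import boolp classical_sets functions cardinality.

Set Implicit Arguments.
Unset Strict Implicit.
Unset Printing Implicit Defensive.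

Import GRing.Theory.

Local Open Scope classical_set_scope.
Local Open Scope card_scope.

(** * Nilpotency from central filtrations and stability groups *)

Section Nilpotency.
Local Open Scope group_scope.
Variable G : groupType.

Lemma is_subgroupP (H : set G) :
  is_subgroup H <-> H 1 /\ forall x y, H x -> H y -> H (x * y^-1).
Proof.
split=> [[H1 HD]|[H1 HD]]; split.
- exact: set_mem H1.
- by move=> x y Hx Hy; apply: set_mem; apply: HD; apply: mem_set.
- exact: mem_set.
- by move=> x y /set_mem Hx /set_mem Hy; apply/mem_set/HD.
Qed.

Lemma generated_min (A H : set G) :
  is_subgroup H -> A `<=` H -> generated A `<=` H.
Proof. exact: smallest_sub. Qed.

Lemma generated_sub (A : set G) : A `<=` generated A.
Proof. exact: sub_gen_smallest. Qed.

(** By induction [lower_central (generated A) n] lies in [U n.+1]. Indices start at 1 because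
    [stabilizer_chain 0], the intended [U 0], need not be closed under inverses. *)
Lemma central_filtration_nilpotent (U : nat -> set G) (c : nat) (A : set G) :
    (forall k, is_subgroup (U k.+1)) ->
    (forall k x y, U k.+1 x -> U 1%N y -> U k.+2 [~ x, y]) ->
    U c.+1 `<=` [set 1] -> A `<=` U 1%N ->
  nilpotent_subgroup (generated A).
Proof.
move=> subU commU Uc AU; exists c; apply: subset_trans Uc.
elim: c => [|c IHc] /=; first exact: generated_min.
apply: generated_min => // z [x [y [/IHc xU yA ->]]].
by apply: commU => //; apply: generated_min yA.
Qed.

Lemma lower_central_iter_comm (H : set G) (x y : nat -> G) :
    H (x 0) -> (forall n, H (y n)) -> (forall n, [~ x n, y n] = x n.+1) ->
  forall n, lower_central H n (x n).
Proof.
move=> x0 yH xy; elim=> [//|n IHn] /=.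
by apply: generated_sub; exists (x n), (y n); rewrite xy.
Qed.

Section StabilityGroup.
Variables (V : zmodType) (act : G -> V -> V) (W : nat -> set V) (c : nat).
Hypothesis act1 : forall v, act 1 v = v.
Hypothesis actM : forall x y v, act (x * y) v = act x (act y v).
Hypothesis actD : forall x u v, act x (u + v)%R = (act x u + act x v)%R.
Hypothesis act_faithful : forall x, (forall v, act x v = v) -> x = 1.
Hypothesis W_0 : forall j, W j 0%R.
Hypothesis WB : forall j u v, W j u -> W j v -> W j (u - v)%R.
Hypothesis W_decr : forall i j, i <= j -> W j `<=` W i.
Hypothesis W_top : forall v, W 0 v.
Hypothesis W_bot : forall v, W c.+1 v -> v = 0%R.

(** For [k = 1] this is the stability group of the chain [W], acting trivially on each quotient of
    [W j] by [W j.+1]. *)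
Definition stabilizer_chain (k : nat) : set G :=
  [set g | forall j v, W j v -> W (j + k) (act g v - v)%R].

Local Lemma WN j v : W j v -> W j (- v)%R.
Proof. by move=> Wv; rewrite -sub0r; apply: WB. Qed.

Local Lemma WD j u v : W j u -> W j v -> W j (u + v)%R.
Proof. by move=> Wu Wv; rewrite -[v]opprK; apply/WB/WN. Qed.

Lemma stabilizer_chain_act k g j v :
  stabilizer_chain k g -> W j v -> W j (act g v).
Proof.
move=> gk Wv; rewrite -(subrK v (act g v)); apply: WD => //.
by apply: W_decr (gk _ _ Wv); rewrite leq_addr.
Qed.

Lemma stabilizer_chainM k x y :
  stabilizer_chain k x -> stabilizer_chain k y -> stabilizer_chain k (x * y).
Proof.
move=> xk yk j v Wv; rewrite actM -(subrK (act y v) (act x _)) -addrA.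
by apply: WD; [apply/xk/(stabilizer_chain_act yk) | apply: yk].
Qed.

Lemma stabilizer_chainV k x :
  stabilizer_chain k.+1 x -> stabilizer_chain k.+1 x^-1.
Proof.
move=> xk j v Wv; set u := act x^-1 v.
have xu : act x u = v by rewrite -actM mulgV act1.
have Wu : W j u.
  (* Since [u = v - (act x u - u)] and [act x u - u] lies deeper than [u], membership climbs from
     [W 0] to [W j] one level at a time. *)
  suff: forall i, i <= j -> W i u by apply.
  elim=> [//|i IHi] lt_ij; rewrite -(subKr v u) -{2}xu.
  apply: WB; first exact: W_decr Wv.
  by apply: W_decr (xk _ _ (IHi (ltnW lt_ij))); rewrite addnS ltnS leq_addr.
by rewrite -opprB -{1}xu; apply/WN/xk.
Qed.

Lemma stabilizer_chain_subgroup k : is_subgroup (stabilizer_chain k.+1).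
Proof.
apply/is_subgroupP; split=> [j v _|x y xk yk]; first by rewrite act1 subrr.
exact/stabilizer_chainM/stabilizer_chainV.
Qed.

(* With x = 1 + a and y = 1 + b as endomorphisms of V, the commutator is
   1 + x^-1 y^-1 (ab - ba). *)
Lemma stabilizer_chain_comm k l x y :
    stabilizer_chain k.+1 x -> stabilizer_chain l.+1 y ->
  stabilizer_chain (k.+1 + l.+1) [~ x, y].
Proof.
move=> xk yl j v Wv.
have actB z u w : act z (u - w)%R = (act z u - act z w)%R.
  by apply/(canRL (addrK _)); rewrite -actD subrK.
have actK z u : act z^-1 (act z u) = u by rewrite -actM mulVg act1.
have -> : (act [~ x, y] v - v =
    act x^-1 (act y^-1 (act x (act y v) - act y (act x v))))%R.
  by rewrite !actB !actK /commg /conjg !actM.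
apply: (stabilizer_chain_act (stabilizer_chainV xk)).
apply: (stabilizer_chain_act (stabilizer_chainV yl)).
have -> : (act x (act y v) - act y (act x v) =
    (act x (act y v - v) - (act y v - v)) -
    (act y (act x v - v) - (act x v - v)))%R.
  by rewrite !actB !opprB addrACA !subrKA.
apply: WB; first by rewrite [(k.+1 + _)%N]addnC addnA; apply/xk/yl.
by rewrite addnA; apply/yl/xk.
Qed.

(** Commutators add the indices of the stabilizers, and [stabilizer_chain c.+1] is trivial: it moves
    every vector of [W 0] by an element of [W c.+1], hence by 0. *)
Lemma stabilizer_chain_nilpotent (A : set G) :
  A `<=` stabilizer_chain 1 -> nilpotent_subgroup (generated A).
Proof.
apply: (@central_filtration_nilpotent stabilizer_chain c).
- exact: stabilizer_chain_subgroup.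
- by move=> k x y xk y1; rewrite -addn1; apply: stabilizer_chain_comm.
- move=> x xc; apply: act_faithful => v.
  by apply/eqP; rewrite -subr_eq0; apply/eqP/W_bot/(xc 0).
Qed.

End StabilityGroup.
End Nilpotency.

(** * Groups generated by a family of involutions of a set *)

Section InvolutionGroup.
Local Open Scope group_scope.
Variables (X : Type) (I : eqType) (s : I -> X -> X).

Definition word_act (w : seq I) : X -> X := foldr (fun i f => s i \o f) id w.

Lemma word_act_cat w1 w2 : word_act (w1 ++ w2) = word_act w1 \o word_act w2.
Proof. by elim: w1 => [|i w1 /= ->]. Qed.

(** The word is only required to exist, so that equality in the group is equality of functions. *)
Record involution_group (sK : forall i, involutive (s i)) : Type :=
  InvolutionGroup {
    involution_group_fun :> X -> X;
    involution_group_word : exists w, involution_group_fun = word_act w }.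

Hypothesis sK : forall i, involutive (s i).

Lemma word_act_rev w : cancel (word_act w) (word_act (rev w)).
Proof.
elim: w => [//|i w IHw] x.
by rewrite rev_cons -cats1 word_act_cat /= sK IHw.
Qed.

Local Notation H := (involution_group sK).

HB.instance Definition _ := gen_eqMixin H.
HB.instance Definition _ := gen_choiceMixin H.

Definition of_word w : H := InvolutionGroup sK (ex_intro _ w erefl).

Definition word_of (g : H) : seq I := sval (cid (involution_group_word g)).

Lemma involution_group_ext (g h : H) : g =1 h -> g = h.
Proof.
case: g h => [f fw] [f' f'w] /= /funext ff'; case: _ / ff' in f'w *.
by congr InvolutionGroup.
Qed.

Lemma word_of_act (g : H) : g = word_act (word_of g) :> (X -> X).
Proof. exact: svalP (cid (involution_group_word g)). Qed.

Lemma word_ofK : cancel word_of of_word.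
Proof.
by move=> g; apply: involution_group_ext => x; rewrite [in RHS]word_of_act.
Qed.

Definition involution_group_one : H := of_word [::].
Definition involution_group_mul (g h : H) : H := of_word (word_of g ++ word_of h).
Definition involution_group_inv (g : H) : H := of_word (rev (word_of g)).

Lemma involution_group_mulE g h :
  involution_group_mul g h = g \o h :> (X -> X).
Proof. by rewrite /= word_act_cat -!word_of_act. Qed.

Fact involution_group_mulA : associative involution_group_mul.
Proof.
by move=> f g h; apply: involution_group_ext => x; rewrite !involution_group_mulE.
Qed.

Fact involution_group_mul1g : left_id involution_group_one involution_group_mul.
Proof.
by move=> f; apply: involution_group_ext => x; rewrite !involution_group_mulE.
Qed.

Fact involution_group_mulg1 : right_id involution_group_one involution_group_mul.
Proof.
by move=> f; apply: involution_group_ext => x; rewrite !involution_group_mulE.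
Qed.

Fact involution_group_mulVg :
  left_inverse involution_group_one involution_group_inv involution_group_mul.
Proof.
move=> f; apply: involution_group_ext => x; rewrite involution_group_mulE /=.
by rewrite word_of_act word_act_rev.
Qed.

Fact involution_group_mulgV :
  right_inverse involution_group_one involution_group_inv involution_group_mul.
Proof.
move=> f; apply: involution_group_ext => x; rewrite involution_group_mulE /=.
by rewrite word_of_act -{1}[word_of f]revK word_act_rev.
Qed.

HB.instance Definition _ := isGroup.Build H involution_group_mulA
  involution_group_mul1g involution_group_mulg1 involution_group_mulVg
  involution_group_mulgV.

Lemma involution_mulgE (g h : H) : g * h = g \o h :> (X -> X).
Proof. exact: involution_group_mulE. Qed.

Definition involution_gen (i : I) : H := of_word [:: i].

Lemma involution_genV i : (involution_gen i)^-1 = involution_gen i.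
Proof.
apply/esym/divg1_eq; rewrite invgK.
by apply: involution_group_ext => x; rewrite involution_mulgE /= sK.
Qed.

Lemma of_word_cons i w : of_word (i :: w) = involution_gen i * of_word w.
Proof. by apply: involution_group_ext => x; rewrite involution_mulgE. Qed.

Lemma of_word_subgroup (U : set H) w :
    is_subgroup U -> {in w, forall i, U (involution_gen i)} ->
  U (of_word w).
Proof.
move=> /is_subgroupP[U1 UD]; elim: w => [|i w IHw] Uw; first exact: U1.
rewrite of_word_cons -[of_word w]invgK; apply: (UD).
  by apply: Uw; rewrite mem_head.
rewrite -[_^-1]mul1g; apply: UD => //; apply: IHw => j wj.
by apply: Uw; rewrite in_cons wj orbT.
Qed.

End InvolutionGroup.

(** * The tree group and its local nilpotency *)

Section TreeGroup.
Local Open Scope group_scope.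
Variables (L : choiceType) (eps : (nat -> L) -> bool).

Let node := option (seq L).
Let V := node -> bool.
Let gen := (seq L + (nat -> L))%type.

(* The generator i adds to the coordinate at e the coordinate at [parent i e]
   whenever [edge i e]. A branch nu is of even type when [eps nu], its edges then
   ending at nodes of odd length. *)
Definition edge (i : gen) (e : node) : bool :=
  match i, e with
  | inl z, Some t => t == z
  | inr nu, Some t =>
      [&& t == mkseq nu (size t), 0 < size t & odd (size t) == eps nu]
  | _, None => false
  end.

Definition parent (i : gen) (e : node) : node :=
  match i, e with
  | inr nu, Some t => Some (mkseq nu (size t).-1)
  | _, _ => None
  end.

Definition tree_gen (i : gen) (v : V) : V :=
  fun e => v e (+) (edge i e && v (parent i e)).

(** The edges of one branch end at lengths of a single parity, and a parent has the other parity;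
    the parent [None] of a node generator ends no edge. This makes [tree_gen i] an involution. *)
Lemma edge_parent i e : edge i e -> edge i (parent i e) = false.
Proof.
case: i e => [z|nu] [t|] //= /and3P[_ t0 /eqP <-].
rewrite size_mkseq; case: (size t) t0 => [//|n _] /=.
by case: (odd n); rewrite !andbF.
Qed.

Lemma tree_genK i : involutive (tree_gen i).
Proof.
move=> v; apply: funext => e; rewrite /tree_gen.
case Ee: (edge i e); rewrite /= ?addbF // edge_parent //= addbF.
by rewrite -addbA addbb addbF.
Qed.

Lemma tree_genD i u v : tree_gen i (u + v)%R = (tree_gen i u + tree_gen i v)%R.
Proof.
apply: funext => e; rewrite /tree_gen !fctE /= /GRing.add /=.
by case: (edge i e) => /=; rewrite ?addbF // addbACA.
Qed.

Definition tree_group := involution_group tree_genK.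

HB.instance Definition _ := Group.on tree_group.

Definition node_gen (z : seq L) : tree_group := involution_gen tree_genK (inl z).
Definition branch_gen (nu : nat -> L) : tree_group :=
  involution_gen tree_genK (inr nu).

Lemma tree_group_actD (g : tree_group) (u v : V) :
  g (u + v)%R = (g u + g v)%R.
Proof.
rewrite (word_of_act g).
by elim: (word_of g) => [//|i w IHw] /=; rewrite IHw tree_genD.
Qed.

Lemma node_gen_neq1 z : node_gen z <> 1.
Proof.
(* The test vector is the basis vector oo, which gains the coordinate at [z]. *)
move=> /(congr1 (fun g : tree_group => g (fun e => e == None) (Some z))).
by rewrite /= /tree_gen /= eqxx.
Qed.

Lemma node_branch_comm (nu : nat -> L) n : odd n.+1 = eps nu ->
  [~ node_gen (mkseq nu n), branch_gen nu] = node_gen (mkseq nu n.+1).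
Proof.
move=> eps_n; rewrite /commg /conjg !involution_genV.
apply: involution_group_ext => v; apply: funext => e.
rewrite !involution_mulgE /= /tree_gen.
case: e => [t|] /=; last by rewrite !addbF.
(* The right-hand side says that a path from oo through [mkseq nu n] reaches [t]; such paths carry
   the commutator's whole effect. *)
have -> : (t == mkseq nu n.+1) =
    [&& t == mkseq nu (size t), 0 < size t & odd (size t) == eps nu] &&
    (mkseq nu (size t).-1 == mkseq nu n).
  apply/eqP/idP => [->|/andP[/and3P[/eqP tE t0 _] /eqP]].
    by rewrite size_mkseq !eqxx eps_n eqxx.
  move=> /(congr1 size); rewrite !size_mkseq => tn.
  by rewrite tE -tn prednK.
set c := [&& _, _ & _].
case: (boolP c) => [/(@edge_parent (inr nu) (Some t)) /= ->|_].
  by case: (_ == _); case: (_ == _); case: (v _); case: (v _); case: (v _).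
by case: (_ == _); case: (v _); case: (v _); case: (v _).
Qed.

Section Rank.
Variables (w : seq gen) (m : nat).
Let branches : seq (nat -> L) :=
  pmap (fun i => if i is inr nu then Some nu else None) w.
Hypothesis m_sep : {in branches &, forall nu nu' k,
  m <= k -> mkseq nu k = mkseq nu' k -> nu = nu'}.

(* Above the level m, where the branches of w are separated, an edge of w is
   never followed by another one, so two more ranks suffice. *)
Definition rank (e : node) : nat :=
  if e isn't Some t then 0 else
  (if size t <= m then size t
   else if has (fun nu => edge (inr nu) e) branches then m.+2 else m.+1).+1.

Lemma rank_edge i e : i \in w -> edge i e -> rank (parent i e) < rank e.
Proof.
case: i e => [z|nu] [t|] // wi Ee; move: (Ee) => /= /and3P[/eqP tE t0 _].
have Bnu : nu \in branches by rewrite mem_pmap; apply/mapP; exists (inr nu).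
rewrite ltnS size_mkseq; case: (leqP (size t) m) => [tm|mt].
  by rewrite (leq_trans (leq_pred _) tm) prednK.
have -> : has (fun nu => edge (inr nu) (Some t)) branches.
  by apply/hasP; exists nu.
case: (leqP (size t).-1 m) => [tm|mt']; first by rewrite ltnS leqW.
(* A second edge ending at the parent would belong to [nu] itself by separation above [m], against
   [edge_parent]. *)
case: hasP => [[nu' Bnu' Enu']|//].
case/and3P: (Enu') => /eqP nunu' _ _.
move: Enu'; rewrite -(m_sep Bnu Bnu' (ltnW mt') nunu').
by have /= := edge_parent Ee; rewrite size_mkseq => ->.
Qed.

Lemma rank_le e : rank e < m.+4.
Proof.
case: e => [t|//] /=; rewrite !ltnS.
by case: ifP => [tm|_]; [rewrite ltnW // leqW | case: ifP].
Qed.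

Definition rank_filtration (j : nat) : set V :=
  [set v | forall e, rank e < j -> v e = false].

(** By [rank_edge] every letter of [w] is unitriangular for [rank_filtration], so words in these
    letters lie in [stabilizer_chain 1]. *)
Lemma nilpotent_generated_words (A : set tree_group) :
    (forall g, A g -> exists2 w', {subset w' <= w} & g = of_word tree_genK w') ->
  nilpotent_subgroup (generated A).
Proof.
move=> Aw.
have W0 j : rank_filtration j 0%R by [].
have WB j u v : rank_filtration j u -> rank_filtration j v ->
    rank_filtration j (u - v)%R.
  by move=> uj vj e je; rewrite !fctE uj // vj.
have Wdecr i j : i <= j -> rank_filtration j `<=` rank_filtration i.
  by move=> ij v vj e ei; rewrite vj // (leq_trans ei).
have act1 (v : V) : (1 : tree_group) v = v by [].
have actM (x y : tree_group) (v : V) : (x * y) v = x (y v).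
  by rewrite involution_mulgE.
have faithful (x : tree_group) : (forall v, x v = v) -> x = 1.
  by move=> xv; apply: involution_group_ext => v; rewrite xv.
have Wtop v : rank_filtration 0 v by [].
have Wbot v : rank_filtration m.+4 v -> v = 0%R.
  by move=> vm; apply: funext => e; rewrite vm // rank_le.
apply: (@stabilizer_chain_nilpotent tree_group V (fun g => g) rank_filtration
  m.+3 act1 actM tree_group_actD faithful W0 WB Wdecr Wtop Wbot) => g /Aw[w' w'w ->].
apply: of_word_subgroup; first exact: stabilizer_chain_subgroup.
move=> i /w'w wi j v vj e; rewrite addn1 ltnS => ej.
have -> : (involution_gen tree_genK i v - v)%R e =
    edge i e && v (parent i e).
  by rewrite !fctE /= /tree_gen; case: (v e); case: (_ && _).
case Ee: (edge i e) => //=.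
by rewrite vj // (leq_trans (rank_edge wi Ee)).
Qed.

End Rank.

End TreeGroup.

(** Each pair of distinct branches differs at some position; [m] exceeds one such position for every
    pair. *)
Lemma branches_separate (L : choiceType) (B : seq (nat -> L)) : exists m,
  {in B &, forall nu nu' k, m <= k -> mkseq nu k = mkseq nu' k -> nu = nu'}.
Proof.
have sep (p : (nat -> L) * (nat -> L)) : exists n, p.1 n = p.2 n -> p.1 = p.2.
  have [/funext E|/existsNP[n nE]] := pselect (p.1 =1 p.2); first by exists 0.
  by exists n => /nE.
have [d dP] := choice sep.
pose pairs := [seq (nu, nu') | nu <- B, nu' <- B].
exists (\max_(p <- pairs) d p).+1 => nu nu' Bnu Bnu' k mk E.
have dk : d (nu, nu') < k.
  apply: leq_trans mk; rewrite ltnS.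
  by apply: (leq_bigmax_seq (nu, nu')) => //; apply: allpairs_f.
apply: (dP (nu, nu')); move: (congr1 (fun s => nth (nu 0) s (d (nu, nu'))) E).
by rewrite /= !nth_mkseq.
Qed.

Lemma tree_group_locally_nilpotent (L : choiceType) (eps : (nat -> L) -> bool) :
  locally_nilpotent (tree_group eps).
Proof.
move=> A /finite_seqP[s ->].
pose w := flatten [seq word_of g | g <- s].
have [m m_sep] := branches_separate
  (pmap (fun i : seq L + (nat -> L) => if i is inr nu then Some nu else None) w).
apply: (nilpotent_generated_words m_sep) => g sg.
exists (word_of g); last by rewrite word_ofK.
by move=> i gi; apply/flatten_mapP; exists g.
Qed.

(** * Cardinality of the tree group *)

Section Cardinality.
Variables (L : choiceType) (a b : L) (code : (nat -> L) -> L).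
Hypothesis ab : a <> b.
Hypothesis code_inj : injective code.

(** Padding the entries with [a] would lose the length, so the even positions record it in unary. *)
Definition seq_stream (s : seq L) (n : nat) : L :=
  if odd n then nth a s n./2 else if n./2 < size s then b else a.

Lemma seq_stream_inj : injective seq_stream.
Proof.
move=> s t st.
have lt_size n : (n < size s) = (n < size t).
  have := congr1 (fun f => f n.*2) st; rewrite /seq_stream odd_double doubleK.
  by case: (n < size s); case: (n < size t) => //= E; case: ab; rewrite E.
have eq_size : size s = size t.
  by case: (ltngtP (size s) (size t)) => //; [rewrite -lt_size|rewrite lt_size];
    rewrite ltnn.
apply: (@eq_from_nth _ a) => // n _.
have := congr1 (fun f => f n.*2.+1) st.
by rewrite /seq_stream /= odd_double /= uphalf_double.
Qed.

Definition gen_stream (i : seq L + (nat -> L)) (n : nat) : L :=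
  match i, n with
  | inl z, 0 => a
  | inl z, n.+1 => seq_stream z n
  | inr nu, 0 => b
  | inr nu, n.+1 => nu n
  end.

Lemma gen_stream_inj : injective gen_stream.
Proof.
move=> [z|nu] [z'|nu'] E.
- congr inl; apply/seq_stream_inj/funext => n.
  exact: (congr1 (fun f => f n.+1) E).
- by case: ab; exact: (congr1 (fun f => f 0) E).
- by case: ab; exact: (congr1 (fun f => f 0) (esym E)).
- congr inr; apply/funext => n; exact: (congr1 (fun f => f n.+1) E).
Qed.

(** An element is recovered from its chosen word; [code] serves twice, for each letter and then for
    the stream of the whole word. *)
Lemma tree_group_card (eps : (nat -> L) -> bool) :
  exists c : tree_group eps -> L, injective c.
Proof.
exists (fun g => code (seq_stream [seq code (gen_stream i) | i <- word_of g])).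
move=> g h /code_inj/seq_stream_inj/inj_map E.
by apply: (can_inj (@word_ofK _ _ _ _)); apply: E; apply: inj_comp gen_stream_inj.
Qed.

End Cardinality.

(** * The diagonal argument against embeddings *)

Lemma gmulf_comm (G H : groupType) (f : {multiplicative G -> H}) (x y : G) :
  (f [~ x, y] = [~ f x, f y])%g.
Proof.
have : (f (y * x) * f [~ x, y] = f (y * x) * [~ f x, f y])%g.
  by rewrite -gmulfM -commgC !gmulfM -commgC.
exact: mulgI.
Qed.

Lemma gmulf_one (G H : groupType) (f : {multiplicative G -> H}) : (f 1 = 1)%g.
Proof. by apply: (mulgI (f 1%g)); rewrite -gmulfM !mulg1. Qed.

(** Course-of-values recursion producing a branch whose entry at [n] is the code of its own prefix
    of length [n]. *)
Fixpoint diagonal_prefix (L : Type) (c : seq L -> L) (n : nat) : seq L :=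
  if n is n'.+1 then rcons (diagonal_prefix c n') (c (diagonal_prefix c n'))
  else [::].

Lemma diagonal_prefixE (L : Type) (c : seq L -> L) n :
  diagonal_prefix c n = mkseq (fun k => c (diagonal_prefix c k)) n.
Proof. by elim: n => [//|n IHn]; rewrite mkseqS -IHn. Qed.

Lemma no_alternating_witness (G : groupType) (x : nat -> G) (y z : G) :
    locally_nilpotent G -> (forall n, x n <> 1%g) ->
    (forall n, ~~ odd n -> [~ x n, y]%g = x n.+1) ->
    (forall n, odd n -> [~ x n, z]%g = x n.+1) -> False.
Proof.
move=> nilG x_neq1 xy xz.
pose A := [set x 0; y; z].
have [n An] : nilpotent_subgroup (generated A) by apply: nilG; rewrite /A.
apply: (x_neq1 n); apply: An.
apply: (lower_central_iter_comm (y := fun n => if odd n then z else y)).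
- by apply: generated_sub; left; left.
- by move=> k; apply: generated_sub; case: (odd k); [right|left; right].
- by move=> k; case: ifP => [/xz|/negbT/xy].
Qed.

Section NonUniversality.
Variables (L : choiceType) (G : groupType) (c : G -> L).
Hypothesis c_inj : injective c.

Definition has_even_witness (nu : nat -> L) : Prop :=
  exists (x : nat -> G) (y : G),
    (forall n, nu n = c (x n)) /\
    forall n, ~~ odd n -> [~ x n, y]%g = x n.+1.

(** The value [true] is the even type: the branch generator then acts from even to odd lengths,
    exactly when [G] has no witness for those steps. *)
Definition opposite_type (nu : nat -> L) : bool := ~~ `[< has_even_witness nu >].

Lemma tree_group_not_embeds :
  locally_nilpotent G -> ~ embeds (tree_group opposite_type) G.
Proof.
move=> nilG [f f_inj].
pose code z := c (f (node_gen opposite_type z)).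
pose nu n := code (diagonal_prefix code n).
pose x n := f (node_gen opposite_type (mkseq nu n)).
have nuE n : nu n = c (x n) by rewrite /nu /code /x diagonal_prefixE.
have x_neq1 n : x n <> 1%g.
  by rewrite -(gmulf_one f) => /f_inj; apply: node_gen_neq1.
have xb n : ~~ odd n = opposite_type nu ->
    [~ x n, f (branch_gen opposite_type nu)]%g = x n.+1.
  by move=> par; rewrite -gmulf_comm node_branch_comm.
have [wit|nowit] := pselect (has_even_witness nu).
  have [x' [y [nuE' xy]]] := wit.
  have x'E : x' = x by apply: funext => n; apply: c_inj; rewrite -nuE -nuE'.
  rewrite {}x'E in xy.
  apply: (no_alternating_witness nilG x_neq1 xy (z := f (branch_gen _ nu))).
  by move=> n n_odd; apply: xb; rewrite n_odd /opposite_type asboolT.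
apply: (nowit); exists x, (f (branch_gen opposite_type nu)); split=> // n n_even.
by apply: xb; rewrite n_even /opposite_type asboolF.
Qed.

End NonUniversality.

(** * Cardinal inequalities as injections, and the conclusion *)

Lemma card_le_injection (T U : Type) :
  [set: T] #<= [set: U] -> exists f : T -> U, injective f.
Proof.
move=> /card_leP[f]; exists (val \o f \o to_setT) => x y /val_inj.
by move=> /'inj_f; rewrite !in_setT => /(_ isT isT) /(congr1 val).
Qed.

Lemma injection_card_le (T U : Type) (f : T -> U) :
  injective f -> [set: T] #<= [set: U].
Proof.
by move=> f_inj; apply: (@card_ge_preimage _ _ setT f) => x y _ _ /f_inj.
Qed.

Theorem theorem1p3 (L : Type)
  (L_infinite : infinite_set [set: L])
  (L_omega : [set: nat -> L] #= [set: L]) :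
  ~ exists G : groupType, universal_in_LN L G.
Proof.
move=> [G [[nilG cardG] univG]].
have [c c_inj] := card_le_injection cardG.
have [/card_le_injection[code code_inj] _] := (card_eqPle _ _).1 L_omega.
have [a [b ab]] : exists a b : L, a <> b.
  have [e e_inj] := card_le_injection ((infiniteP _).1 L_infinite).
  by exists (e 0), (e 1) => /e_inj.
pose LC : choiceType := {classic L}.
apply: (@tree_group_not_embeds LC G c c_inj nilG); apply: univG; split.
  exact: tree_group_locally_nilpotent.
have [d d_inj] :=
  @tree_group_card LC a b code ab code_inj (opposite_type (L := LC) c).
exact: injection_card_le d_inj.
Qed.
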